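(* There exist absolute constants $c,C>0$ such that the following holds. Let $\varepsilon\in(0,1/6]$ and $\gamma\in(0,1)$ satisfy $\gamma^{1/\gamma}\le\varepsilon$, let $d$ be an integer with $d\ge C\log(1/\gamma)/\gamma$, and let $\eta\ge c\,\gamma\,\varepsilon\log(1/\varepsilon)$. Then there exist a distribution $\mathcal D$ over $\{\pm1\}^d\times\{\pm1\}$ whose marginal on $\{\pm1\}^d$ is uniform and whose label is a deterministic function of $\mathbf x$, and a distribution $\widehat{\mathcal D}$ with $d_{\mathrm{TV}}(\mathcal D,\widehat{\mathcal D})\le\eta$, such that the class $\mathcal H=\{\mathrm{proj}_i: i\in[d]\}$, $\mathrm{proj}_i(x)=x_i$, satisfies the $\gamma$-weak learning assumption with respect to $\mathcal D$, and for every impurity function $\mathcal G$ and every $t< 2^{\,d - C\log(1/\gamma)/\gamma}$, there is a way of breaking ties in $\textsc{TopDownDT}_{\mathcal H,\mathcal G,\widehat{\mathcal D}}(t)$ for which the output tree $T$ satisfies $\Pr_{(\mathbf x,\mathbf y)\sim\mathcal D}[T(\mathbf x)\ne\mathbf y]>\varepsilon$.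
   Context: Labels and splitting-function values in $\{\pm1\}$ are identified with $\{0,1\}$ via $-1\leftrightarrow 0$, $+1\leftrightarrow 1$. An impurity function is a concave $\mathcal G:[0,1]\to[0,1]$, symmetric around $1/2$, with $\mathcal G(0)=\mathcal G(1)=0$ and $\mathcal G(1/2)=1$. For a distribution $\mathcal E$ write $\mu(\mathcal E)=\Pr_{\mathcal E}[\mathbf y=1]$; for a splitting function $h$ let $\mathcal E|_{h=b}$ denote $\mathcal E$ conditioned on $h(\mathbf x)=b$ and $\Delta_{\mathcal E}(h)=\mathcal G(\mu(\mathcal E))-\sum_{b}\Pr_{\mathcal E}[h(\mathbf x)=b]\,\mathcal G(\mu(\mathcal E|_{h=b}))$ (zero-probability terms are $0$). A decision tree over $\mathcal H$ is a rooted binary tree whose internal nodes are labeled by functions in $\mathcal H$, inputs being routed to the child indexed by the function's value, with labeled leaves; size = number of leaves. For leaf $\ell$, $w_{\mathcal E}(\ell)=\Pr_{\mathcal E}[\mathbf x\text{ reaches }\ell]$, $\mathcal E_\ell$ is $\mathcal E$ conditioned on reaching $\ell$, and $T_{\ell,h}$ replaces leaf $\ell$ by an internal node labeled $h$ with two leaf children. $\textsc{TopDownDT}_{\mathcal H,\mathcal G,\mathcal E}(t)$: start from a single leaf; while size$(T)<t$, pick $(\ell^\star,h^\star)$ maximizing $w_{\mathcal E}(\ell)\Delta_{\mathcal E_\ell}(h)$ over leaves $\ell$ and $h\in\mathcal H$, breaking ties arbitrarily, and set $T\leftarrow T_{\ell^\star,h^\star}$; finally label each leaf $\ell$ by $\mathbf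 1[\mu(\mathcal E_\ell)>1/2]$. Induced distribution: $\mathcal D$ conditioned on an event $h_1(\mathbf x)=b_1,\dots,h_k(\mathbf x)=b_k$ of positive probability ($k\ge0$, $h_i\in\mathcal H$). $\gamma$-weak learning assumption w.r.t. $\mathcal D$: for every induced $\mathcal D'$ there is $h\in\mathcal H$ with $|\mathrm{Cov}_{\mathcal D'}[h(\mathbf x),\mathbf y]|\ge\gamma\,\mathrm{Var}_{\mathcal D'}[\mathbf y]$. $d_{\mathrm{TV}}$ is total variation distance. *)

(* Defs.v *)
From HB Require Import structures.
From mathcomp Require Import all_boot all_order all_algebra.
From mathcomp Require Import reals exp Rstruct.
Set Implicit Arguments. Unset Strict Implicit. Unset Printing Implicit Defensive.
Import Order.TTheory GRing.Theory Num.Theory.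
Local Open Scope ring_scope.

Section Defs.
Variable R : realType.
Variable d : nat.

(* inputs x in {±1}^d encoded as boolean vectors (-1 <-> false, +1 <-> true) *)
Definition inp := {ffun 'I_d -> bool}.
(* labelled examples (x, y), y in {±1} encoded as bool *)
Definition ex := (inp * bool)%type.

Definition is_dist (P : ex -> R) : Prop :=
  (forall z, 0 <= P z) /\ \sum_z P z = 1.

Definition mass (P : ex -> R) (A : pred ex) : R := \sum_(z | A z) P z.

Definition dTV (P Q : ex -> R) : R := 2^-1 * \sum_z `|P z - Q z|.

Definition uniform_deterministic (P : ex -> R) : Prop :=
  exists f : inp -> bool, forall x y,
    P (x, y) = if y == f x then (2 ^+ d)^-1 else 0.

Definition pm (b : bool) : R := if b then 1 else -1.

Definition proj (i : 'I_d) (x : inp) : bool := x i.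

Definition cond_event (s : seq ('I_d * bool)) : pred ex :=
  fun z => all (fun ib => proj ib.1 z.1 == ib.2) s.

Definition cexp (P : ex -> R) (A : pred ex) (f : ex -> R) : R :=
  (\sum_(z | A z) P z * f z) / mass P A.

Definition ccov (P : ex -> R) (A : pred ex) (f g : ex -> R) : R :=
  cexp P A (fun z => f z * g z) - cexp P A f * cexp P A g.

Definition cvar (P : ex -> R) (A : pred ex) (f : ex -> R) : R :=
  cexp P A (fun z => f z ^+ 2) - cexp P A f ^+ 2.

Definition weak_learning (gamma : R) (P : ex -> R) : Prop :=
  forall s : seq ('I_d * bool), 0 < mass P (cond_event s) ->
  exists i : 'I_d,
    `| ccov P (cond_event s) (fun z => pm (proj i z.1)) (fun z => pm z.2) |
      >= gamma * cvar P (cond_event s) (fun z => pm z.2).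

Definition in01 (x : R) := (0 <= x) && (x <= 1).
Definition impurity (G : R -> R) : Prop :=
  [/\ forall x y t, in01 x -> in01 y -> in01 t ->
        t * G x + (1 - t) * G y <= G (t * x + (1 - t) * y),
      forall x, in01 x -> G x = G (1 - x),
      forall x, in01 x -> in01 (G x),
      G 0 = 0 /\ G 1 = 0 & G (2^-1) = 1].

(* decision trees over H; an internal node is labelled by the index i of proj_i;
   input x goes to the right child iff proj_i x = true (+1) *)
Inductive dtree := Leaf | Node of 'I_d & dtree & dtree.

Fixpoint tsize (T : dtree) : nat :=
  match T with Leaf => 1 | Node _ l r => tsize l + tsize r end.

(* leaves are addressed by paths (sequence of branch values from the root) *)
Fixpoint is_leaf (T : dtree) (p : seq bool) : bool :=
  match T, p with
  | Leaf, [::] => true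
  | Node _ l r, b :: p' => is_leaf (if b then r else l) p'
  | _, _ => false
  end.

Fixpoint reaches (T : dtree) (p : seq bool) (x : inp) : bool :=
  match T, p with
  | _, [::] => true
  | Node i l r, b :: p' => (proj i x == b) && reaches (if b then r else l) p' x
  | Leaf, _ :: _ => false
  end.

Fixpoint graft (T : dtree) (p : seq bool) (i : 'I_d) : dtree :=
  match T, p with
  | Leaf, [::] => Node i Leaf Leaf
  | Node j l r, b :: p' =>
      if b then Node j l (graft r p' i) else Node j (graft l p' i) r
  | _, _ => T
  end.

Fixpoint leaf_path (T : dtree) (x : inp) : seq bool :=
  match T with
  | Leaf => [::]
  | Node i l r => proj i x :: leaf_path (if proj i x then r else l) x
  end.

Definition region (T : dtree) (p : seq bool) : pred ex := fun z => reaches T p z.1.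

Definition cmu (P : ex -> R) (A : pred ex) : R :=
  mass P (fun z => A z && z.2) / mass P A.

(* Pr_P[A] * G(mu(P|A)); zero when Pr_P[A] = 0 *)
Definition wG (G : R -> R) (P : ex -> R) (A : pred ex) : R :=
  mass P A * G (cmu P A).

(* w_P(l) * Delta_{P_l}(proj_i), for the leaf at path p of T *)
Definition wscore (G : R -> R) (P : ex -> R) (T : dtree) (p : seq bool) (i : 'I_d) : R :=
  wG G P (region T p)
  - wG G P (fun z => region T p z && (proj i z.1 == false))
  - wG G P (fun z => region T p z && (proj i z.1 == true)).

Definition td_step (G : R -> R) (P : ex -> R) (T T' : dtree) : Prop :=
  exists (p : seq bool) (i : 'I_d),
    [/\ is_leaf T p, T' = graft T p i &
        forall (q : seq bool) (j : 'I_d), is_leaf T q -> wscore G P T q j <= wscore G P T p i].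

Inductive td_run (G : R -> R) (P : ex -> R) : nat -> dtree -> Prop :=
  | td_run0 : td_run G P 0 Leaf
  | td_runS n T T' : td_run G P n T -> td_step G P T T' -> td_run G P n.+1 T'.

(* each step adds one leaf, so the loop "while size(T) < t" performs
   exactly t.-1 steps (zero steps when t <= 1) *)
Definition TopDownDT_output (G : R -> R) (P : ex -> R) (t : nat) (T : dtree) : Prop :=
  td_run G P t.-1 T.

(* leaf labels 1[mu(P_l) > 1/2] (with the convention 0/0 = 0 for empty leaves) *)
Definition predict (P : ex -> R) (T : dtree) (x : inp) : bool :=
  cmu P (region T (leaf_path T x)) > 2^-1.

Definition error (D : ex -> R) (P : ex -> R) (T : dtree) : R :=
  mass D (fun z => predict P T z.1 != z.2).

End Defs.

(* Main.v *)
Require Import Defs.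
From mathcomp Require Import all_boot all_order all_algebra.
From mathcomp Require Import reals exp Rstruct.
From mathcomp Require Import ring lra zify.
Import Order.TTheory GRing.Theory Num.Theory.
Local Open Scope ring_scope.
Set Implicit Arguments. Unset Strict Implicit.

(* The target is a read-once DNF ("tribes"): the OR of m disjoint ANDs of width
   w, on m w < d coordinates, with Pr[f = 0] = q^m just above eps, where
   q = 1 - 2^-w and 2^w is about 1 / (gamma ln (1/eps)).  In a subcube where f
   is not constant, a free variable of a tribe that is not yet falsified has
   covariance at least 2 p / (2^w - 1) with f, p = Pr[f = 0] there, against a
   variance 4 p (1 - p); hence weak learning as soon as 2 gamma (2^w - 1) <= 1.
   The adversary mixes in, with weight lam, points whose m w tribe variables
   all equal 1, labelled 0.  For lam = q^(m-1) 2^-w / (1 - q^m), which is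
   O(gamma eps ln (1/eps)), every coordinate is uncorrelated with the label and
   all root splits have score 0.  This persists after splitting on a
   coordinate i0 that f ignores, so top-down induction may split on i0 forever;
   the resulting tree computes a constant, of error q^m or 1 - q^m. *)

(** * Sums of product functions over the cube, and the block structure *)

Lemma sum_ffun_prod (R : comNzRingType) (d : nat) (v : 'I_d -> bool -> R) :
  \sum_(x : {ffun 'I_d -> bool}) \prod_i v i (x i) =
  \prod_i (v i false + v i true).
Proof.
rewrite -(bigA_distr_bigA v); apply: eq_bigr => i _.
by rewrite big_bool addrC.
Qed.

(* Induction on m: block m contributes the difference of the sums for [v] and
   for [v] with the coordinates of that block forced to true. *)
Lemma sum_tribes (R : comNzRingType) (d m : nat) (blk : 'I_d -> nat)
    (v : 'I_d -> bool -> R) :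
  \sum_(x : {ffun 'I_d -> bool})
    (\prod_i v i (x i)) * \prod_(j < m) (1 - \prod_(i | blk i == j) (x i)%:R) =
  (\prod_(i | (m <= blk i)%N) (v i false + v i true)) *
  \prod_(j < m) (\prod_(i | blk i == j) (v i false + v i true)
                 - \prod_(i | blk i == j) v i true).
Proof.
elim: m v => [|m IHm] v.
  rewrite big_ord0 mulr1 -sum_ffun_prod.
  by apply: eq_bigr => x _; rewrite big_ord0 mulr1.
pose v' i (b : bool) := if blk i == m then b%:R * v i b else v i b.
have vE (x : {ffun 'I_d -> bool}) :
    (\prod_i v i (x i)) * \prod_(i | blk i == m) (x i)%:R = \prod_i v' i (x i).
  rewrite [X in _ * X]big_mkcond -big_split; apply: eq_bigr => i _ /=.
  by rewrite /v'; case: ifP; rewrite ?mulr1 // mulrC.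
transitivity (\sum_(x : {ffun 'I_d -> bool})
    ((\prod_i v i (x i)) * \prod_(j < m) (1 - \prod_(i | blk i == j) (x i)%:R)
   - (\prod_i v' i (x i)) *
       \prod_(j < m) (1 - \prod_(i | blk i == j) (x i)%:R))).
  by apply: eq_bigr => x _; rewrite big_ord_recr /= -vE; ring.
rewrite sumrB !IHm big_ord_recr /=.
have splitm (F : 'I_d -> R) : \prod_(i | (m <= blk i)%N) F i =
    (\prod_(i | blk i == m) F i) * \prod_(i | (m < blk i)%N) F i.
  rewrite (bigID (fun i => blk i == m)) /=; congr (_ * _); apply: eq_bigl => i.
    by case: eqP => [->|_]; rewrite ?leqnn ?andbT ?andbF.
  by rewrite ltn_neqAle andbC eq_sym.
have v'lt (j : 'I_m) (F : (bool -> R) -> R) :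
    \prod_(i | blk i == j) F (v' i) = \prod_(i | blk i == j) F (v i).
  apply: eq_bigr => i /eqP bi; congr F.
  by rewrite /v' bi ltn_eqF.
rewrite !splitm.
have -> : \prod_(i | blk i == m) (v' i false + v' i true) =
    \prod_(i | blk i == m) v i true.
  by apply: eq_bigr => i bi; rewrite /v' bi mul0r add0r mul1r.
have -> : \prod_(i | (m < blk i)%N) (v' i false + v' i true) =
    \prod_(i | (m < blk i)%N) (v i false + v i true).
  by apply: eq_bigr => i bi; rewrite /v' gtn_eqF.
have -> : \prod_(j < m) (\prod_(i | blk i == j) (v' i false + v' i true)
                 - \prod_(i | blk i == j) v' i true) =
   \prod_(j < m) (\prod_(i | blk i == j) (v i false + v i true)
                 - \prod_(i | blk i == j) v i true).
  apply: eq_bigr => j _.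
  by rewrite (v'lt j (fun f => f false + f true)) (v'lt j (fun f => f true)).
ring.
Qed.

Lemma prod_blocks (R : comNzRingType) (d m : nat) (blk : 'I_d -> nat)
    (F : 'I_d -> R) :
  \prod_i F i = (\prod_(i | (m <= blk i)%N) F i) *
                \prod_(j < m) \prod_(i | blk i == j) F i.
Proof.
elim: m => [|m IHm]; first by rewrite big_ord0 mulr1.
rewrite IHm big_ord_recr /= (bigID (fun i => blk i == m)) /=.
rewrite [LHS]mulrC [X in _ * X = _]mulrC [LHS]mulrCA; congr (_ * (_ * _)).
  by apply: eq_bigl => i; rewrite ltn_neqAle andbC eq_sym.
by apply: eq_bigl => i; case: eqP => [->|_]; rewrite ?leqnn ?andbT ?andbF.
Qed.

Lemma card_block (d m w j : nat) :
  (0 < w)%N -> (m * w <= d)%N -> (j < m)%N ->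
  #|[pred i : 'I_d | (i %/ w == j)%N]| = w.
Proof.
move=> w0 le_mw_d lt_jm.
have lt_d (r : 'I_w) : (j * w + r < d)%N.
  by have := ltn_ord r; nia.
rewrite -[RHS]card_ord -(card_image (f := fun r : 'I_w => Ordinal (lt_d r))).
  apply: eq_card => i; rewrite !inE; apply/eqP/imageP => [bi|[r _ ->]] /=.
    have lt_r : (i %% w < w)%N by rewrite ltn_mod.
    by exists (Ordinal lt_r) => //; apply: val_inj; rewrite /= -bi -divn_eq.
  by rewrite divnMDl // divn_small ?addn0.
by move=> r r' /(congr1 val) /= /addnI /val_inj.
Qed.

(** * The tribes function, its labelled distribution and the decoys *)

Section Tribes.
Variables (R : realType) (d m w : nat).

(** For positive w, indices from [m * w] on fall in blocks numbered m or more, which [tribes]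
    ignores. *)
Definition blk (i : 'I_d) : nat := (i %/ w)%N.

Definition tribes (x : inp d) : bool :=
  [exists j : 'I_m, [forall i, (blk i == j) ==> x i]].

Lemma not_tribesE (x : inp d) :
  (~~ tribes x)%:R =
  \prod_(j < m) (1 - \prod_(i | blk i == j) (x i)%:R) :> R.
Proof.
have allE (j : 'I_m) : \prod_(i | blk i == j) (x i)%:R =
    [forall i, (blk i == j) ==> x i]%:R :> R.
  case: (boolP [forall i, _]) => [/forallP xj|].
    by apply: big1 => i bi; have := xj i; rewrite bi /= => ->.
  rewrite negb_forall => /existsP[i]; rewrite negb_imply => /andP[bi /negbTE xi].
  by rewrite (bigD1 i) //= xi mul0r.
rewrite /tribes negb_exists.
case: (boolP [forall j, _]) => [/forallP no|].
  by rewrite big1 // => j _; rewrite allE (negbTE (no j)) subr0.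
rewrite negb_forall => /existsP[j]; rewrite negbK => yes.
by rewrite (bigD1 j) //= allE yes subrr mul0r.
Qed.

Definition tribes_dist (z : ex d) : R :=
  if z.2 == tribes z.1 then (2 ^+ d)^-1 else 0.

(** A factor [2 * x_i] is the density, relative to a fair bit, of a bit stuck at 1; coordinates
    outside the tribes stay uniform. *)
Definition decoy (z : ex d) : R :=
  (~~ z.2)%:R *
  ((2 ^+ d)^-1 * \prod_i (if (blk i < m)%N then 2 * (z.1 i)%:R else 1)).

Lemma sum_ex (F : ex d -> R) :
  \sum_z F z = \sum_x (F (x, true) + F (x, false)).
Proof.
transitivity (\sum_(x : inp d) \sum_(y : bool) F (x, y)).
  by rewrite pair_big; apply: eq_bigr => -[].
by apply: eq_bigr => x _; rewrite big_bool.
Qed.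

Lemma sum_tribes_dist (F : ex d -> R) :
  \sum_z tribes_dist z * F z =
  (2 ^+ d)^-1 * \sum_x F (x, tribes x).
Proof.
rewrite mulr_sumr sum_ex; apply: eq_bigr => x _.
by rewrite /tribes_dist /=; case: tribes; rewrite /= mul0r ?addr0 ?add0r.
Qed.

(** * Weak learning on subcubes *)

Lemma pm_tribes x : pm R (tribes x) = 1 - 2 * (~~ tribes x)%:R.
Proof. by rewrite /pm; case: tribes => /=; ring. Qed.

(** Conditions in s may repeat or contradict each other; a contradiction at i leaves neither value
    of i compatible, which makes the indicator product vanish. *)
Definition compatible (s : seq ('I_d * bool)) (i : 'I_d) (b : bool) : bool :=
  all (fun ib => (ib.1 == i) ==> (b == ib.2)) s.

Lemma cond_eventE s (z : ex d) :
  (cond_event s z)%:R = \prod_i (compatible s i (z.1 i))%:R :> R.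
Proof.
case: (boolP (cond_event s z)) => [/allP sz|].
  rewrite big1 // => i _; suff -> : compatible s i (z.1 i) by [].
  by apply/allP => -[k b] /sz /=; rewrite /proj /= => kb; apply/implyP => /eqP <-.
rewrite -has_predC => /hasP[[i b] ib_s /= neq_b].
rewrite (bigD1 i) //=; suff -> : compatible s i (z.1 i) = false by rewrite mul0r.
apply/negbTE; rewrite -has_predC; apply/hasP; exists (i, b) => //=.
by rewrite eqxx.
Qed.

(** Conditioning on literals keeps a product space, so every expectation needed factors over the
    tribes by [sum_tribes]. The condition on gamma comes from comparing the covariance 2 p / (U -
    1), U <= 2^w, with the variance 4 p (1 - p). *)
Lemma weak_learning_tribes (gamma : R) :
  (0 < w)%N -> (0 < d)%N -> (m * w <= d)%N ->
  0 < gamma -> 2 * gamma * (2 ^+ w - 1) <= 1 ->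
  weak_learning gamma tribes_dist.
Proof.
move=> w0 d0 le_mw_d gamma0 gamma_w s mass_s.
pose v i (b : bool) : R := (compatible s i b)%:R.
pose S (g : ex d -> R) : R := \sum_(x : inp d) (\prod_i v i (x i)) * g (x, tribes x).
have two_d : (2 ^+ d)^-1 != 0 :> R by rewrite invr_eq0 expf_neq0 ?pnatr_eq0.
have sumE (g : ex d -> R) :
    \sum_(z | cond_event s z) tribes_dist z * g z = (2 ^+ d)^-1 * S g.
  rewrite big_mkcond /S -(sum_tribes_dist (fun z => (\prod_i v i (z.1 i)) * g z)).
  apply: eq_bigr => z _; rewrite -cond_eventE.
  by case: ifP => _; rewrite ?mul1r // mul0r mulr0.
have SE g : cexp tribes_dist (cond_event s) g = S g / S (fun=> 1).
  rewrite /cexp sumE /mass.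
  under [X in _ / X]eq_bigr do rewrite -[tribes_dist _]mulr1.
  by rewrite sumE -mulf_div divff // mul1r.
have N0 : 0 < S (fun=> 1).
  have := mass_s; rewrite /mass.
  under [X in _ < X]eq_bigr do rewrite -[tribes_dist _]mulr1.
  by rewrite sumE pmulr_rgt0 // invr_gt0 exprn_gt0.
set N := S _ in SE N0.
pose Z := S (fun z => (~~ z.2)%:R).
pose V (j : nat) := \prod_(i | blk i == j) v i true.
pose U (j : nat) := \prod_(i | blk i == j) (v i false + v i true).
have ZE : Z = (\prod_(i | (m <= blk i)%N) (v i false + v i true)) *
    \prod_(j < m) (U j - V j).
  by rewrite -sum_tribes; apply: eq_bigr => x _; rewrite /= not_tribesE.
have NE : N = (\prod_(i | (m <= blk i)%N) (v i false + v i true)) *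
    \prod_(j < m) U j.
  rewrite -prod_blocks -sum_ffun_prod.
  by apply: eq_bigr => x _; rewrite mulr1.
have Z0 : 0 <= Z.
  apply: sumr_ge0 => x _; apply: mulr_ge0 => //; apply: prodr_ge0 => i _.
  exact: ler0n.
have varE : cvar tribes_dist (cond_event s) (fun z => pm R z.2) =
    4 * (Z / N) * (1 - Z / N).
  rewrite /cvar !SE.
  have -> : S (fun z => pm R z.2 ^+ 2) = N.
    apply: eq_bigr => x _ /=; congr (_ * _).
    by rewrite /pm; case: tribes; ring.
  have -> : S (fun z => pm R z.2) = N - 2 * Z.
    rewrite /N /Z /S mulr_sumr -sumrB; apply: eq_bigr => x _.
    by rewrite /= pm_tribes; ring.
  by field; rewrite gt_eqF.
(* Where f is constant the variance is 0, so any coordinate will do. *)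
have triv : Z = 0 \/ Z = N -> exists i : 'I_d,
    gamma * cvar tribes_dist (cond_event s) (fun z => pm R z.2) <=
    `|ccov tribes_dist (cond_event s) (fun z => pm R (proj i z.1))
        (fun z => pm R z.2)|.
  move=> ZN; exists (Ordinal d0).
  suff -> : gamma * cvar tribes_dist (cond_event s) (fun z => pm R z.2) = 0 by [].
  rewrite varE; case: ZN => ->; first by rewrite mul0r mulr0 mul0r mulr0.
  by rewrite divff ?gt_eqF // subrr !mulr0.
have [Zeq0|Zn0] := eqVneq Z 0; first by apply: triv; left.
(* [V j] is nonzero exactly when no variable of tribe j is fixed to false. If every tribe has such a
   variable, f is constantly 0 and [Z = N]. *)
case: (boolP [exists j : 'I_m, V j != 0]) => [/existsP[j Vj]|]; last first.
  rewrite negb_exists => /forallP V0; apply: triv; right; rewrite ZE NE.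
  congr (_ * _); apply: eq_bigr => j _.
  by move: (V0 j); rewrite negbK => /eqP ->; rewrite subr0.
have v1 i : blk i == j -> v i true = 1.
  move=> bi; apply/eqP; move: Vj; apply: contraNT => vi.
  rewrite /V (bigD1 i) //=; move: vi; rewrite /v.
  by case: compatible; rewrite ?eqxx // mul0r.
have Vj1 : V j = 1 by apply: big1 => i bi; rewrite v1.
have UVj : U j - V j != 0.
  move: Zn0; rewrite ZE; apply: contraNneq => UV0.
  by rewrite (bigD1 j) //= UV0 mul0r mulr0.
(* If all variables of tribe j were fixed to true, then [U j = V j] and [Z = 0]; so tribe j has a
   free variable i. *)
case: (boolP [exists i, (blk i == j) && (v i false == 1)]) => [/existsP[i]|]; last first.
  rewrite negb_exists => /forallP no; case/eqP: UVj; apply/eqP.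
  rewrite subr_eq0; apply/eqP; apply: eq_bigr => i bi.
  move: (no i); rewrite bi /= /v.
  by case: (compatible s i false); rewrite ?eqxx // add0r.
case/andP=> bi /eqP vi0; exists i.
(* The sign of x_i is absorbed into the weight of coordinate i, so that [sum_tribes] also evaluates
   sums twisted by this sign. *)
pose v' k (b : bool) := if k == i then pm R b * v k b else v k b.
have v'E (x : inp d) : \prod_k v' k (x k) = \prod_k v k (x k) * pm R (x i).
  rewrite (bigD1 i) //= [in RHS](bigD1 i) //=.
  rewrite (eq_bigr (fun k => v k (x k))); first by rewrite /v' eqxx; ring.
  by move=> k /negbTE; rewrite /v' => ->.
pose X := S (fun z => pm R (proj i z.1) * (~~ z.2)%:R).
have v's : v' i false + v' i true = 0.
  by rewrite /v' eqxx vi0 (v1 _ bi) /pm; ring.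
have X0 : S (fun z => pm R (proj i z.1)) = 0.
  transitivity (\prod_k (v' k false + v' k true)).
    by rewrite -sum_ffun_prod; apply: eq_bigr => x _; rewrite v'E.
  by rewrite (bigD1 i) //= v's mul0r.
(* The signed weight of i sums to 0, so factor j turns from [U j - 1] into [-1], while all other
   factors stay. *)
have XE : X * (U j - 1) = - Z.
  have -> : X = (\prod_(i | (m <= blk i)%N) (v i false + v i true)) *
     \prod_(j0 < m) (if j0 == j then - 1 else U j0 - V j0).
    transitivity (\sum_(x : inp d) (\prod_k v' k (x k)) *
      \prod_(j0 < m) (1 - \prod_(k | blk k == j0) (x k)%:R)).
      by apply: eq_bigr => x _; rewrite v'E -not_tribesE /= mulrA.
    rewrite sum_tribes; congr (_ * _).
      apply: eq_bigr => k; rewrite /v'; case: eqP => [->|//].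
      by rewrite (eqP bi) leqNgt ltn_ord.
    apply: eq_bigr => j0 _; case: eqVneq => [->|neq_j].
      rewrite (bigD1 i) //= v's mul0r sub0r; congr (- _).
      by apply: big1 => k bk; rewrite /v' v1 // /pm; case: ifP; rewrite ?mul1r.
    congr (_ - _); apply: eq_bigr => k /eqP bk; rewrite /v'; case: eqP => // ki;
      by case/eqP: neq_j; apply: val_inj; rewrite /= -bk ki (eqP bi).
  rewrite ZE -Vj1 (bigD1 j) //= eqxx [in RHS](bigD1 j) //= Vj1.
  rewrite [X in _ * (_ * X)](eq_bigr (fun j0 : 'I_m => U j0 - V j0)).
    by ring.
  by move=> j0 /negbTE ->.
(* [U j] is 2 to the number of free variables of tribe j, which lies between 1 and w. *)
have Uj1 : 0 < U j - 1 /\ U j - 1 <= 2 ^+ w - 1.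
  have vb k b : v k b = 0 \/ v k b = 1.
    by rewrite /v; case: compatible; [right|left].
  split.
    rewrite lt_neqAle eq_sym -{1}Vj1 UVj /= -Vj1 subr_ge0.
    apply: ler_prod => k _.
    by case: (vb k true) => ->; case: (vb k false) => ->; lra.
  rewrite lerB // -(card_block w0 le_mw_d (ltn_ord j)) -prodr_const.
  apply: ler_prod => k _.
  by case: (vb k true) => ->; case: (vb k false) => ->; lra.
have covE : ccov tribes_dist (cond_event s) (fun z => pm R (proj i z.1))
        (fun z => pm R z.2) = - 2 * (X / N).
  rewrite /ccov !SE X0 mul0r mul0r subr0.
  have -> : S (fun z => pm R (proj i z.1) * pm R z.2) =
      S (fun z => pm R (proj i z.1)) - 2 * X.
    rewrite /X /S mulr_sumr -sumrB; apply: eq_bigr => x _.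
    by rewrite /= pm_tribes; ring.
  by rewrite X0; ring.
have [U1 Uw] := Uj1.
have {}covE : ccov tribes_dist (cond_event s) (fun z => pm R (proj i z.1))
        (fun z => pm R z.2) = 2 * (Z / N) / (U j - 1).
  have -> : Z = - (X * (U j - 1)) by rewrite XE opprK.
  by rewrite covE; field; rewrite !gt_eqF.
have ZN0 : 0 <= Z / N by rewrite divr_ge0 // ltW.
rewrite varE covE ger0_norm; last by rewrite !mulr_ge0 // invr_ge0 ltW.
rewrite ler_pdivlMr //.
have gU : 2 * gamma * (U j - 1) <= 1.
  by apply: le_trans gamma_w; rewrite ler_pM2l // mulr_gt0.
have gU0 : 0 <= 2 * gamma * (U j - 1) by rewrite ltW // !mulr_gt0.
have -> : gamma * (4 * (Z / N) * (1 - Z / N)) * (U j - 1) =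
  2 * (Z / N) * ((2 * gamma * (U j - 1)) * (1 - Z / N)) by ring.
apply: ler_piMr; first by rewrite mulr_ge0.
by nra.
Qed.

(** * Total and label-0 masses of product-form events *)

Definition weighted (P : ex d -> R) (v : 'I_d -> bool -> R) : R :=
  \sum_z P z * \prod_i v i (z.1 i).

Definition weighted_neg (P : ex d -> R) (v : 'I_d -> bool -> R) : R :=
  \sum_z P z * ((~~ z.2)%:R * \prod_i v i (z.1 i)).

Lemma weighted_tribes v :
  weighted tribes_dist v = (2 ^+ d)^-1 * \prod_i (v i false + v i true).
Proof.
by rewrite /weighted (sum_tribes_dist (fun z => \prod_i v i (z.1 i))) sum_ffun_prod.
Qed.

(** Tribes are independent under a product weight, and [c j] is the probability that tribe j fails.
    The hypothesis is multiplicative so that a block of total weight 0 needs no separate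
    treatment. *)
Lemma weighted_neg_tribes v (c : nat -> R) :
  (forall j, (j < m)%N ->
    \prod_(i | blk i == j) (v i false + v i true) - \prod_(i | blk i == j) v i true
    = c j * \prod_(i | blk i == j) (v i false + v i true)) ->
  weighted_neg tribes_dist v = (\prod_(j < m) c j) * weighted tribes_dist v.
Proof.
move=> vc; rewrite weighted_tribes mulrCA /weighted_neg.
rewrite (sum_tribes_dist (fun z => (~~ z.2)%:R * \prod_i v i (z.1 i))) /=.
congr (_ * _).
transitivity (\sum_(x : inp d) (\prod_k v k (x k)) *
    \prod_(j < m) (1 - \prod_(k | blk k == j) (x k)%:R)).
  by apply: eq_bigr => x _; rewrite not_tribesE mulrC.
rewrite sum_tribes (prod_blocks m blk) mulrCA -big_split /=.
by congr (_ * _); apply: eq_bigr => j _; rewrite vc.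
Qed.

Lemma weighted_decoy v :
  weighted decoy v =
  (2 ^+ d)^-1 * \prod_i (if (blk i < m)%N then 2 * v i true
                         else v i false + v i true).
Proof.
pose v' i (b : bool) := if (blk i < m)%N then 2 * b%:R * v i b else v i b.
transitivity ((2 ^+ d)^-1 * \prod_i (v' i false + v' i true)); last first.
  congr (_ * _); apply: eq_bigr => i _; rewrite /v'; case: ifP => _ //=.
  by ring.
rewrite -sum_ffun_prod mulr_sumr /weighted sum_ex; apply: eq_bigr => x _.
rewrite /decoy /= !mul0r add0r mul1r -mulrA -big_split; congr (_ * _).
by apply: eq_bigr => i _; rewrite /v' /=; case: ifP; rewrite ?mul1r.
Qed.

Lemma weighted_neg_decoy v : weighted_neg decoy v = weighted decoy v.
Proof.
apply: eq_bigr => z _; rewrite mulrA; congr (_ * _).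
by rewrite /decoy; case: z.2; rewrite /= ?mul0r ?mulr1.
Qed.

Lemma weightedD (P Q : ex d -> R) (a b : R) v :
  weighted (fun z => a * P z + b * Q z) v = a * weighted P v + b * weighted Q v.
Proof.
by rewrite /weighted !mulr_sumr -big_split; apply: eq_bigr => z _ /=; ring.
Qed.

Lemma weighted_negD (P Q : ex d -> R) (a b : R) v :
  weighted_neg (fun z => a * P z + b * Q z) v =
  a * weighted_neg P v + b * weighted_neg Q v.
Proof.
by rewrite /weighted_neg !mulr_sumr -big_split; apply: eq_bigr => z _ /=; ring.
Qed.

Definition corrupted (lam : R) (z : ex d) : R :=
  (1 - lam) * tribes_dist z + lam * decoy z.

Definition tribe_false : R := 1 - (2 ^+ w)^-1.

Hypotheses (w_gt0 : (0 < w)%N) (le_mw_d : (m * w <= d)%N).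

Lemma prod2_block j : (j < m)%N -> \prod_(i : 'I_d | blk i == j) 2 = 2 ^+ w :> R.
Proof. by move=> lt_jm; rewrite prodr_const (card_block w_gt0 le_mw_d lt_jm). Qed.

Lemma weighted_neg_free v :
  (forall i b, (blk i < m)%N -> v i b = 1) ->
  weighted_neg tribes_dist v = tribe_false ^+ m * weighted tribes_dist v.
Proof.
move=> v1; rewrite (weighted_neg_tribes (c := fun=> tribe_false)).
  by rewrite prodr_const card_ord.
move=> j lt_jm.
rewrite [X in _ - X]big1 => [|i /eqP bi]; last by rewrite v1 // bi.
rewrite (eq_bigr (fun=> 2)) => [|i /eqP bi]; last by rewrite !v1 // bi.
by rewrite prod2_block // /tribe_false mulrBl mul1r mulVf // expf_neq0 ?pnatr_eq0.
Qed.

(** Fixing x_k = 0 makes the tribe of k fail for sure; the other m - 1 tribes still fail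
    independently with their usual probability. *)
Lemma weighted_neg_false v k :
  (blk k < m)%N -> v k false = 1 -> v k true = 0 ->
  (forall i b, (blk i < m)%N -> i != k -> v i b = 1) ->
  weighted_neg tribes_dist v = tribe_false ^+ m.-1 * weighted tribes_dist v.
Proof.
move=> lt_km vk0 vk1 v1.
rewrite (weighted_neg_tribes (c := fun j => if j == blk k then 1 else tribe_false)).
  congr (_ * _); rewrite (bigD1 (Ordinal lt_km)) //= eqxx mul1r.
  rewrite (eq_bigr (fun=> tribe_false)) => [|j /negbTE]; last first.
    by rewrite -val_eqE /= => ->.
  by rewrite prodr_const cardC1 card_ord.
move=> j lt_jm; case: eqVneq => [->|neq_jk].
  by rewrite [X in _ - X](bigD1 k) //= vk1 mul0r subr0 mul1r.
have nk i : blk i == j -> (blk i < m)%N /\ i != k.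
  move=> /eqP bi; split; first by rewrite bi.
  by apply: contraNneq neq_jk => ik; rewrite -bi ik.
rewrite [X in _ - X]big1 => [|i /nk[? ?]]; last by rewrite v1.
rewrite (eq_bigr (fun=> 2)) => [|i /nk[? ?]]; last by rewrite !v1.
by rewrite prod2_block // /tribe_false mulrBl mul1r mulVf // expf_neq0 ?pnatr_eq0.
Qed.

Lemma weighted_decoy_free v :
  (forall i b, (blk i < m)%N -> v i b = 1) ->
  weighted decoy v = weighted tribes_dist v.
Proof.
move=> v1; rewrite weighted_decoy weighted_tribes; congr (_ * _).
by apply: eq_bigr => i _; case: ifP => // bi; rewrite !v1 // mulr1.
Qed.

Lemma weighted_decoy_false v k :
  (blk k < m)%N -> v k true = 0 -> weighted decoy v = 0.
Proof.
by move=> bk vk; rewrite weighted_decoy (bigD1 k) //= bk vk mulr0 mul0r mulr0.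
Qed.

Lemma mass_weighted P (A : pred (ex d)) (v : 'I_d -> bool -> R) :
  (forall z, (A z)%:R = \prod_i v i (z.1 i)) ->
  mass P A = weighted P v /\ mass P (fun z => A z && ~~ z.2) = weighted_neg P v.
Proof.
move=> Av; split; rewrite /mass big_mkcond; apply: eq_bigr => z _; rewrite -Av.
  by case: (A z); rewrite ?mulr1 ?mulr0.
by case: (A z); case: z.2; rewrite /= ?mulr1 ?mulr0 ?mul0r.
Qed.

Lemma weighted_tribes1 : weighted tribes_dist (fun _ _ => 1) = 1.
Proof.
rewrite weighted_tribes prodr_const card_ord -[1 + 1]/(2%:R) mulVf //.
by rewrite expf_neq0 // pnatr_eq0.
Qed.

Lemma sum_weighted1 (P : ex d -> R) : \sum_z P z = weighted P (fun _ _ => 1).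
Proof. by apply: eq_bigr => z _; rewrite big1 ?mulr1. Qed.

Lemma tribes_dist_ge0 z : 0 <= tribes_dist z.
Proof. by rewrite /tribes_dist; case: ifP => // _; rewrite invr_ge0 exprn_ge0. Qed.

Lemma decoy_ge0 z : 0 <= decoy z.
Proof.
rewrite !mulr_ge0 ?ler0n ?invr_ge0 ?exprn_ge0 //; apply: prodr_ge0 => i _.
by case: ifP; rewrite ?mulr_ge0 ?ler0n.
Qed.

Lemma is_dist_tribes : is_dist tribes_dist.
Proof.
by split; [exact: tribes_dist_ge0 | rewrite sum_weighted1 weighted_tribes1].
Qed.

Lemma sum_decoy : \sum_z decoy z = 1.
Proof. by rewrite sum_weighted1 weighted_decoy_free // weighted_tribes1. Qed.

Lemma is_dist_corrupted lam : 0 <= lam <= 1 -> is_dist (corrupted lam).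
Proof.
case/andP=> lam0 lam1; split=> [z|].
  by rewrite addr_ge0 // mulr_ge0 ?subr_ge0 ?tribes_dist_ge0 ?decoy_ge0.
by rewrite big_split -!mulr_sumr sum_decoy (proj2 is_dist_tribes) !mulr1 /= subrK.
Qed.

Lemma dTV_corrupted lam : 0 <= lam -> dTV tribes_dist (corrupted lam) <= lam.
Proof.
move=> lam0; rewrite /dTV.
apply: (@le_trans _ _ (2^-1 * \sum_z lam * (tribes_dist z + decoy z))).
  rewrite ler_pM2l ?invr_gt0 //; apply: ler_sum => z _.
  have -> : tribes_dist z - corrupted lam z = lam * (tribes_dist z - decoy z).
    by rewrite /corrupted; ring.
  rewrite normrM ger0_norm // ler_wpM2l //; apply: (le_trans (ler_normB _ _)).
  by rewrite !ger0_norm ?tribes_dist_ge0 ?decoy_ge0.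
rewrite -mulr_sumr big_split /= sum_decoy (proj2 is_dist_tribes).
by rewrite mulrCA [_ * (1 + 1)]mulVf ?mulr1 // pnatr_eq0.
Qed.

(** * Events on which label 0 keeps one common frequency *)

Variable lam : R.
(* The right-hand side is Pr[y = 0 | x_i = 0] for any tribe variable i, and it
   does not depend on lam since the decoys have x_i = 1. *)
Hypothesis lamE : (1 - lam) * tribe_false ^+ m + lam = tribe_false ^+ m.-1.

(** A conditional frequency of label 0, cleared of its denominator because the events met below may
    be null. *)
Definition balanced (A : pred (ex d)) : Prop :=
  mass (corrupted lam) (fun z => A z && ~~ z.2) =
  tribe_false ^+ m.-1 * mass (corrupted lam) A.

(** Such an event has the same mass under the genuine and the decoy part and is independent of the
    tribes, so label 0 has the mixed frequency on the left of [lamE]. *)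
Lemma balanced_free (A : pred (ex d)) (v : 'I_d -> bool -> R) :
  (forall z, (A z)%:R = \prod_i v i (z.1 i)) ->
  (forall i b, (blk i < m)%N -> v i b = 1) -> balanced A.
Proof.
move=> Av v1; rewrite /balanced.
have [-> ->] := mass_weighted (corrupted lam) Av.
rewrite weightedD weighted_negD weighted_neg_decoy weighted_neg_free //.
rewrite weighted_decoy_free // -lamE; ring.
Qed.

(** Decoys never have x_k = 0, so only the genuine part remains, with one tribe already
    falsified. *)
Lemma balanced_false (A : pred (ex d)) (v : 'I_d -> bool -> R) k :
  (forall z, (A z)%:R = \prod_i v i (z.1 i)) ->
  (blk k < m)%N -> v k false = 1 -> v k true = 0 ->
  (forall i b, (blk i < m)%N -> i != k -> v i b = 1) -> balanced A.
Proof.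
move=> Av lt_km vk0 vk1 v1; rewrite /balanced.
have [-> ->] := mass_weighted (corrupted lam) Av.
rewrite weightedD weighted_negD weighted_neg_decoy.
rewrite (weighted_neg_false lt_km) // (weighted_decoy_false lt_km) //; ring.
Qed.

Lemma mass_split (P : ex d -> R) (A : pred (ex d)) j :
  mass P A = mass P (fun z => A z && (proj j z.1 == false))
           + mass P (fun z => A z && (proj j z.1 == true)).
Proof.
rewrite /mass (bigID (fun z => proj j z.1 == false)) /=; congr (_ + _).
by apply: eq_bigl => z; case: (proj j z.1); rewrite ?andbT ?andbF.
Qed.

Lemma eq_mass (P : ex d -> R) (A B : pred (ex d)) : A =1 B -> mass P A = mass P B.
Proof. exact: eq_bigl. Qed.

Lemma prod_implies (i0 : 'I_d) (a : pred bool) (x : inp d) :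
  \prod_i ((i == i0) ==> a (x i))%:R = (a (x i0))%:R :> R.
Proof. by rewrite (bigD1 i0) //= eqxx big1 ?mulr1 // => i /negbTE ->. Qed.

(** Both sides of the defining equation are additive in the event, so subtraction gives the other
    half. *)
Lemma balanced_true (A : pred (ex d)) j :
  balanced A -> balanced (fun z => A z && (proj j z.1 == false)) ->
  balanced (fun z => A z && (proj j z.1 == true)).
Proof.
rewrite /balanced => balA balF.
have massA := mass_split (corrupted lam) A j.
have := mass_split (corrupted lam) (fun z => A z && ~~ z.2) j.
have swap c : mass (corrupted lam) (fun z => A z && ~~ z.2 && (proj j z.1 == c)) =
    mass (corrupted lam) (fun z => A z && (proj j z.1 == c) && ~~ z.2).
  by apply: eq_mass => z; rewrite andbAC.
by rewrite !swap balA balF massA mulrDr => /addrI.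
Qed.

Lemma balanced_cylinder (i0 : 'I_d) (a : pred bool) :
  (m <= blk i0)%N -> balanced (fun z => a (z.1 i0)).
Proof.
move=> le_m_i0.
apply: (balanced_free (v := fun i c => ((i == i0) ==> a c)%:R)) => [z|i c lt_im].
  by rewrite prod_implies.
by case: eqP => // ii0; rewrite ii0 ltnNge le_m_i0 in lt_im.
Qed.

(** If j is ignored, the slice only involves ignored coordinates. If j is a tribe variable, the half
    x_j = 0 falsifies a tribe and the half x_j = 1 follows by subtraction. *)
Lemma balanced_slice (i0 j : 'I_d) (a : pred bool) (b : bool) :
  (m <= blk i0)%N -> balanced (fun z => a (z.1 i0) && (proj j z.1 == b)).
Proof.
move=> le_m_i0.
have bal0 := balanced_cylinder a le_m_i0.
pose v c i e : R := ((i == i0) ==> a e)%:R * ((i == j) ==> (e == c))%:R.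
have vE c (z : ex d) : (a (z.1 i0) && (proj j z.1 == c))%:R = \prod_i v c i (z.1 i).
  rewrite big_split /= prod_implies (prod_implies j (fun e => e == c)).
  by rewrite /proj -natrM mulnb.
have v1 c i e : (blk i < m)%N -> i != j -> v c i e = 1.
  rewrite /v => lt_im /negbTE ->; case: eqP => [ii0|]; rewrite ?mulr1 //.
  by rewrite ii0 ltnNge le_m_i0 in lt_im.
have [le_mj|lt_jm] := leqP m (blk j).
  apply: (balanced_free (vE b)) => i e lt_im; apply: v1 => //.
  by apply: contraTneq lt_im => ->; rewrite -leqNgt.
have balF : balanced (fun z => a (z.1 i0) && (proj j z.1 == false)).
  have ji0 : j == i0 = false.
    by apply: contraTF lt_jm => /eqP ->; rewrite -leqNgt.
  apply: (balanced_false (vE false) lt_jm); rewrite /v ?ji0 ?eqxx ?mulr1 ?mulr0 //.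
  by move=> i e; apply: v1.
case: b; last exact: balF.
exact: (balanced_true bal0 balF).
Qed.

Lemma cmu_balanced (A : pred (ex d)) :
  balanced A -> mass (corrupted lam) A != 0 ->
  cmu (corrupted lam) A = 1 - tribe_false ^+ m.-1.
Proof.
rewrite /balanced /cmu => bal A0.
apply: (mulIf A0); rewrite divfK // mulrBl mul1r -bal.
by rewrite [X in _ = X - _]/mass (bigID (fun z => z.2)) /= addrK.
Qed.

(** On balanced events [wG] is proportional to mass with one common factor, so splitting a balanced
    event into balanced halves scores 0 whatever G is. *)
Lemma wG_balanced (G : R -> R) (A : pred (ex d)) :
  balanced A ->
  wG G (corrupted lam) A = mass (corrupted lam) A * G (1 - tribe_false ^+ m.-1).
Proof.
rewrite /wG => bal.
have [->|A0] := eqVneq (mass (corrupted lam) A) 0; first by rewrite !mul0r.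
by rewrite cmu_balanced.
Qed.

(** * Trees that query a single ignored coordinate *)

Fixpoint only_label (i0 : 'I_d) (T : dtree d) : bool :=
  if T is Node i l r then [&& i == i0, only_label i0 l & only_label i0 r]
  else true.

Lemma reaches_only_label (i0 : 'I_d) (T : dtree d) (p : seq bool) :
  only_label i0 T -> exists a : pred bool, forall x, reaches T p x = a (x i0).
Proof.
elim: T p => [|i l IHl r IHr] [|b p] /=.
- by exists predT.
- by exists pred0.
- by exists predT.
case/and3P=> /eqP -> onl onr.
have [a aE] : exists a : pred bool, forall x,
    reaches (if b then r else l) p x = a (x i0).
  by case: b; [exact: IHr | exact: IHl].
by exists (fun c => (c == b) && a c) => x; rewrite aE.
Qed.

Lemma only_label_graft (i0 : 'I_d) (T : dtree d) (p : seq bool) :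
  only_label i0 T -> only_label i0 (graft T p i0).
Proof.
elim: T p => [|i l IHl r IHr] [|[] p] //=; rewrite ?eqxx //.
  by case/and3P=> -> -> /IHr ->.
by case/and3P=> -> /IHl -> ->.
Qed.

Lemma exists_leaf (T : dtree d) : exists p, is_leaf T p.
Proof.
elim: T => [|i l [p lp] r _]; first by exists [::].
by exists (false :: p).
Qed.

Lemma reaches_leaf_path (T : dtree d) (x : inp d) : reaches T (leaf_path T x) x.
Proof. by elim: T => //= i l IHl r IHr; rewrite eqxx; case: proj. Qed.

Lemma wscore_only_label (G : R -> R) (i0 : 'I_d) T p j :
  (m <= blk i0)%N -> only_label i0 T -> wscore G (corrupted lam) T p j = 0.
Proof.
move=> le_m_i0 /(reaches_only_label p)[a aE].
have regE : region T p =1 (fun z => a (z.1 i0)) by move=> z; apply: aE.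
have eq_wG (A B : pred (ex d)) : A =1 B ->
    wG G (corrupted lam) A = wG G (corrupted lam) B.
  move=> AB; rewrite /wG /cmu !(eq_mass _ AB); congr (_ * G (_ / _)).
  by apply: eq_mass => z; rewrite AB.
rewrite /wscore (eq_wG _ _ regE).
have slice c : wG G (corrupted lam) (fun z => region T p z && (proj j z.1 == c)) =
    wG G (corrupted lam) (fun z => a (z.1 i0) && (proj j z.1 == c)).
  by apply: eq_wG => z; rewrite regE.
rewrite !slice.
rewrite !wG_balanced; try exact: balanced_slice; last exact: balanced_cylinder.
by rewrite (mass_split _ _ j); ring.
Qed.

(* All scores vanish, so a split on i0 is a legal tie-break, even at a leaf whose
   path already queries i0 (one child then has mass zero). *)
Lemma td_run_only_label (G : R -> R) (i0 : 'I_d) n :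
  (m <= blk i0)%N ->
  exists T, td_run G (corrupted lam) n T /\ only_label i0 T.
Proof.
move=> le_m_i0; elim: n => [|n [T [runT onT]]].
  by exists (Leaf d); split => //; constructor.
have [p leaf_p] := exists_leaf T.
exists (graft T p i0); split; last exact: only_label_graft.
apply: td_runS runT _; exists p, i0; split=> // q j _.
by rewrite !(wscore_only_label _ _ _ le_m_i0).
Qed.

(** Some leaves may be empty and have mean 0 by default, but the leaf reached by x contains
    [(x, tribes x)], of positive mass as [lam < 1]; its mean is thus the balanced one. *)
Lemma predict_only_label (i0 : 'I_d) T x :
  (m <= blk i0)%N -> 0 <= lam < 1 -> only_label i0 T ->
  predict (corrupted lam) T x = (2^-1 < 1 - tribe_false ^+ m.-1).
Proof.
move=> le_m_i0 /andP[lam0 lam1] onT; rewrite /predict; congr (_ < _).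
have [a aE] := reaches_only_label (leaf_path T x) onT.
have regE : region T (leaf_path T x) =1 (fun z => a (z.1 i0)) by move=> z; apply: aE.
have mass_gt0 : 0 < mass (corrupted lam) (fun z => a (z.1 i0)).
  rewrite /mass (bigD1 (x, tribes x)) /=; last by rewrite -aE reaches_leaf_path.
  have P0 z : 0 <= corrupted lam z.
    by rewrite addr_ge0 // mulr_ge0 ?tribes_dist_ge0 ?decoy_ge0 // subr_ge0 ltW.
  have Px : 0 < corrupted lam (x, tribes x).
    rewrite /corrupted ltr_wpDr //; first by apply: mulr_ge0 => //; exact: decoy_ge0.
    rewrite mulr_gt0 ?subr_gt0 //.
    by rewrite /tribes_dist /= eqxx invr_gt0 exprn_gt0.
  by rewrite ltr_wpDr // sumr_ge0.
rewrite -(cmu_balanced (balanced_cylinder a le_m_i0)) ?gt_eqF //.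
rewrite /cmu (eq_mass _ regE); congr (_ / _).
by apply: eq_mass => z; rewrite regE.
Qed.

Lemma mass_tribes_neg : mass tribes_dist (fun z => ~~ z.2) = tribe_false ^+ m.
Proof.
have T1 (z : ex d) : (xpredT z)%:R = \prod_(i : 'I_d) 1 :> R by rewrite big1.
have [_ /=] := mass_weighted tribes_dist (A := xpredT) (v := fun _ _ => 1) T1.
by move=> ->; rewrite weighted_neg_free // weighted_tribes1 mulr1.
Qed.

Lemma mass_tribes_pos : mass tribes_dist (fun z => z.2) = 1 - tribe_false ^+ m.
Proof.
rewrite -mass_tribes_neg -(proj2 is_dist_tribes) (bigID (fun z => z.2)) /=.
by rewrite addrK.
Qed.

Lemma error_only_label (i0 : 'I_d) T (eps : R) :
  (m <= blk i0)%N -> 0 <= lam < 1 -> only_label i0 T ->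
  eps < tribe_false ^+ m -> eps < 1 - tribe_false ^+ m ->
  eps < error tribes_dist (corrupted lam) T.
Proof.
move=> le_m_i0 lam01 onT eps_neg eps_pos; rewrite /error.
rewrite (eq_mass _ (B := fun z => (2^-1 < 1 - tribe_false ^+ m.-1) != z.2)).
  case: (2^-1 < _).
    by rewrite (eq_mass _ (B := fun z => ~~ z.2)) ?mass_tribes_neg // => -[x []].
  by rewrite (eq_mass _ (B := fun z => z.2)) ?mass_tribes_pos // => -[x []].
by move=> z; rewrite (predict_only_label _ le_m_i0).
Qed.

End Tribes.

(** * Choice of the width, the number of tribes and the decoy weight *)

Lemma ln_inv_ge (R : realType) (x : R) : 0 < x -> 1 - x <= ln x^-1.
Proof.
move=> x0; rewrite lnV // lerNr opprB.
by have := @le_ln1Dx R (x - 1); rewrite addrCA subrr addr0; apply; lra.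
Qed.

Lemma ln2_ge (R : realType) : 2^-1 <= ln 2 :> R.
Proof.
by have := @ln_inv_ge R 2^-1; rewrite invrK => /(_ _)/(le_trans _); apply; lra.
Qed.

(** The exponent is kept positive because it becomes a tribe width. The price is the case [n = 0],
    where 2 may exceed [2 * a]. *)
Lemma pow2_approx (R : realType) (a : R) : 0 < a ->
  exists n, a < 2 ^+ n.+1 /\ (n = 0%N \/ 2 ^+ n.+1 <= 2 * a).
Proof.
move=> a_gt0; pose n := trunc_log 2 (Num.truncn a); exists n; split.
  apply: (lt_le_trans (truncnS_gt a)); rewrite -natrX ler_nat.
  exact: trunc_log_ltn.
have [->|n_gt0] := posnP n; [by left | right].
move: n_gt0; rewrite trunc_log_gt0 /= => a0; rewrite exprS ler_pM2l // -natrX.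
apply: (@le_trans _ _ (Num.truncn a)%:R); last by rewrite truncn_le ltW.
by rewrite ler_nat trunc_logP // (leq_ltn_trans _ a0).
Qed.

(** m is the last exponent whose power exceeds eps; [ln (1 - u) <= - u] keeps all such exponents
    below [ln eps^-1 / u]. *)
Lemma max_power_gt (R : realType) (u eps : R) :
  0 < u -> u < 1 -> 0 < eps -> eps < 1 - u ->
  exists m, [/\ (0 < m)%N, eps < (1 - u) ^+ m, (1 - u) ^+ m.+1 <= eps
    & m%:R * u < ln eps^-1].
Proof.
move=> u0 u1 eps0 eps_u.
have q_gt0 : 0 < 1 - u by rewrite subr_gt0.
have bound k : eps < (1 - u) ^+ k -> k%:R * u < ln eps^-1.
  move=> eps_k.
  have : ln eps < ln ((1 - u) ^+ k) by rewrite ltr_ln ?posrE ?exprn_gt0.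
  rewrite lnXn // => ln_k.
  have lnq : ln (1 - u) <= - u by apply: le_ln1Dx; rewrite ltrN2.
  rewrite lnV // ltrNr; apply: (lt_le_trans ln_k); rewrite -mulrN.
  by have := ler_wpM2l (ler0n R k) lnq; rewrite mulr_natl.
have L0 : 0 <= ln eps^-1 / u.
  rewrite divr_ge0 ?ltW // ln_gt0 // invf_gt1 //.
  by apply: (lt_trans eps_u); rewrite ltrBlDr ltrDl.
have [|k|m eps_m max_m] :=
    @ex_maxnP (fun k => eps < (1 - u) ^+ k) (Num.truncn (ln eps^-1 / u)).
- by exists 1%N; rewrite expr1.
- by move/bound; rewrite -ltr_pdivlMr // => /ltW; rewrite truncn_ge_nat.
exists m; split=> //; last exact: bound.
  by apply: max_m; rewrite expr1.
by rewrite leNgt; apply/negP => /max_m; rewrite ltnn.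
Qed.

(** With a = 1 / (4 gamma L) and L = ln (1/eps), the width satisfies a < 2^w and, unless w = 1, 2^w
    <= 2 a. The first bound gives 2^-w <= 4 gamma L, the second 2 gamma 2^w <= 4 gamma a = 1 / L <=
    1. Then m is maximal with q^m > eps. *)
Lemma tribes_parameters (R : realType) (eps gamma : R) :
  0 < eps -> eps <= 6^-1 -> 0 < gamma -> gamma < 1 ->
  powR gamma gamma^-1 <= eps ->
  exists m w : nat, [/\ (0 < w)%N, (0 < m)%N,
    2 * gamma * (2 ^+ w - 1) <= 1 /\ (2 ^+ w)^-1 <= 4 * gamma * ln eps^-1,
    eps < tribe_false R w ^+ m /\ tribe_false R w ^+ m.+1 <= eps &
    (m * w).+1%:R <= 3 * ln gamma^-1 / gamma].
Proof.
move=> eps0 eps6 gamma0 gamma1 gamma_eps.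
set L := ln eps^-1; set X := ln gamma^-1 / gamma.
have LX : L <= X.
  have : ln (powR gamma gamma^-1) <= ln eps.
    by rewrite ler_ln // posrE powR_gt0.
  by rewrite ln_powR /L /X !lnV //; lra.
have L4 : 2 * ln 2 <= L.
  rewrite mulr_natl -lnXn // ler_ln ?posrE ?invr_gt0 ?exprn_gt0 //.
  by rewrite -[_ ^+ 2]invrK lef_pV2 ?posrE // ?invr_gt0 ?exprn_gt0 //; lra.
have L1 : 1 <= L.
  by have := @ln2_ge R; lra.
(* This settles width 1. If gamma > 1/2, then X < 2 ln 2 = ln 4, while eps <= 1/6 forces L >= ln 4,
   against [LX]. *)
have gamma_half : gamma <= 2^-1.
  rewrite leNgt; apply/negP => gamma_gt.
  have inv_lt : gamma^-1 < 2 by rewrite -[2]invrK ltf_pV2 ?posrE // invr_gt0.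
  have ln_le : ln gamma^-1 <= ln 2 by rewrite ler_ln ?posrE ?invr_gt0 // ltW.
  have ln_gt : 0 < ln gamma^-1 by rewrite ln_gt0 // invf_gt1.
  have : X < 2 * ln 2.
    apply: (@lt_le_trans _ _ (ln gamma^-1 * 2)); first by rewrite ltr_pM2l.
    by rewrite mulrC ler_pM2l.
  by move: LX L4; lra.
pose a := (4 * gamma * L)^-1.
have a_gt0 : 0 < a by rewrite invr_gt0 !mulr_gt0 // (lt_le_trans ltr01).
have aE : a * (4 * gamma * L) = 1.
  by rewrite mulVf // gt_eqF // !mulr_gt0 // (lt_le_trans ltr01).
have ga : 4 * gamma * a <= 1.
  have : 0 <= gamma * a * (L - 1).
    by apply: mulr_ge0; [rewrite ltW ?mulr_gt0 | rewrite subr_ge0].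
  by move: aE; lra.
have [n [a_lt n_le]] := pow2_approx a_gt0.
have W_gt0 : 0 < 2 ^+ n.+1 :> R by rewrite exprn_gt0.
have W_inv0 : 0 < (2 ^+ n.+1)^-1 :> R by rewrite invr_gt0.
have W_inv : (2 ^+ n.+1)^-1 <= 2^-1 :> R.
  by rewrite lef_pV2 ?posrE // exprS ler_peMr // exprn_ege1 // ler1n.
have u_lt1 : (2 ^+ n.+1)^-1 < 1 :> R by apply: (le_lt_trans W_inv); lra.
have eps_u : eps < 1 - (2 ^+ n.+1)^-1.
  by rewrite ltrBrDl (le_lt_trans (lerD W_inv eps6)) //; lra.
have [m [m_gt0 eps_m m_eps m_lt]] := max_power_gt W_inv0 u_lt1 eps0 eps_u.
exists m, n.+1; split=> //.
- split; last by rewrite -[4 * gamma * L]invrK lef_pV2 ?posrE // ltW.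
  case: n_le => [->|W_le].
    by rewrite expr1; lra.
  have : gamma * 2 ^+ n.+1 <= gamma * (2 * a) by rewrite ler_pM2l.
  move: (2 ^+ n.+1) {W_le a_lt W_gt0 W_inv0 W_inv u_lt1 eps_u eps_m m_eps m_lt} => W.
  by move: ga gamma0; lra.
(* The extra coordinate costs 1 <= L <= X, turning 2 X into 3 X. *)
suff : m%:R * n.+1%:R <= 2 * X.
  move=> mn; rewrite -natr1 natrM -mulrA -/X.
  by move: mn LX L1; clear; lra.
have {}m_lt : m%:R < L * 2 ^+ n.+1 by rewrite -ltr_pdivrMr.
(* For width 1, m < 2 L. Otherwise m <= 1 / (2 gamma) and w <= 2 ln (1/gamma), whose product is
   X. *)
case: n_le => [n0|W_le].
  by move: m_lt; rewrite n0 expr1 mulr1; lra.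
have m_le : m%:R <= (2 * gamma)^-1.
  rewrite -[leRHS]mul1r ler_pdivlMr ?mulr_gt0 //.
  have : m%:R * gamma <= L * (2 * a) * gamma.
    rewrite ler_pM2r // (le_trans (ltW m_lt)) // ler_pM2l //.
    exact: lt_le_trans ltr01 L1.
  by move: aE; clear; lra.
have w_le : n.+1%:R <= 2 * ln gamma^-1.
  have : ln (2 ^+ n.+1) <= ln gamma^-1.
    rewrite ler_ln ?posrE ?invr_gt0 // -[leRHS]mul1r ler_pdivlMr //.
    apply: (@le_trans _ _ (2 * a * gamma)); first by rewrite ler_pM2r.
    by move: ga; clear; lra.
  rewrite lnXn // => ln_le.
  have := ler_wpM2l (ler0n R n.+1) (ln2_ge R); rewrite [_ * ln 2]mulr_natl.
  by move: (n.+1%:R) (ln 2 *+ n.+1) ln_le => k l; clear; lra.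
apply: (@le_trans _ _ ((2 * gamma)^-1 * (2 * ln gamma^-1))).
  by apply: ler_pM.
have -> : (2 * gamma)^-1 * (2 * ln gamma^-1) = X by rewrite /X; field; rewrite gt_eqF.
by move: LX L1; clear; lra.
Qed.

(** Meant for u = 2^-w and x = q^(m-1), where the quotient is lam. As 1 - u >= 1/2, the last premise
    gives x <= 4 eps and (1 - u) x <= 2 eps <= 1/3; then 6 = 4 / (1 - 1/3). *)
Lemma decoy_weight_bound (R : realType) (eps u x : R) :
  0 < eps -> eps <= 6^-1 -> 0 < u -> u <= 2^-1 -> 0 <= x ->
  (1 - u) ^+ 2 * x <= eps ->
  [/\ 0 < 1 - (1 - u) * x, (1 - u) * x <= 3^-1,
      x * u / (1 - (1 - u) * x) <= 6 * eps * u &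
      6 * eps * u < 1].
Proof.
move=> eps0 eps6 u0 u2 x0 ux_eps.
have x4 : x <= 4 * eps.
  have : 2^-1 * 2^-1 * x <= (1 - u) ^+ 2 * x.
    by apply: ler_wpM2r => //; rewrite expr2 ler_pM //; lra.
  lra.
have qx : (1 - u) * x <= 2 * eps.
  have : 2^-1 * ((1 - u) * x) <= (1 - u) ^+ 2 * x.
    rewrite expr2 -mulrA; apply: ler_wpM2r; last lra.
    by apply: mulr_ge0 => //; lra.
  lra.
have pos : 0 < 1 - (1 - u) * x by lra.
split=> //; first lra.
  rewrite ler_pdivrMr // mulrAC; apply: ler_wpM2r; first exact: ltW.
  have : eps * (1 - (1 - u) * x) >= eps * (2 / 3).
    by rewrite ler_pM2l //; lra.
  lra.
have : eps * u <= 6^-1 * 2^-1 by rewrite ler_pM // ltW.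
lra.
Qed.

(** * Assembly of the construction *)

Theorem theorem4p1 :
  exists c C : Rdefinitions.R, 0 < c /\ 0 < C /\
  forall (eps gamma eta : Rdefinitions.R) (d : nat),
    0 < eps -> eps <= 6^-1 ->
    0 < gamma -> gamma < 1 ->
    powR gamma gamma^-1 <= eps ->
    C * ln gamma^-1 / gamma <= d%:R ->
    c * gamma * eps * ln eps^-1 <= eta ->
    exists D Dhat : ex d -> Rdefinitions.R,
      [/\ is_dist D /\ uniform_deterministic D, is_dist Dhat,
          dTV D Dhat <= eta,
          weak_learning gamma D &
          forall G : Rdefinitions.R -> Rdefinitions.R, impurity G ->
          forall t : nat, t%:R < powR 2 (d%:R - C * ln gamma^-1 / gamma) ->
          exists T : dtree d,
            TopDownDT_output G Dhat t T /\ error D Dhat T > eps].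
Proof.
(* 24 = 6 * 4, from lam <= 6 eps 2^-w and 2^-w <= 4 gamma ln (1/eps). The 3 comes from the bound on
   m w + 1, which leaves a coordinate outside the tribes. *)
exists 24, 3; split; first lra; split; first lra.
move=> eps gamma eta d eps0 eps6 gamma0 gamma1 gamma_eps le_d le_eta.
have [m [w [w0 m0 [gamma_w w_gamma] [eps_lt eps_ge] mw_le]]] :=
  tribes_parameters eps0 eps6 gamma0 gamma1 gamma_eps.
have lt_mw_d : (m * w < d)%N by rewrite -(ler_nat Rdefinitions.R); exact: le_trans le_d.
have le_mw_d := ltnW lt_mw_d.
pose R : realType := Rdefinitions.R.
pose u : R := (2 ^+ w)^-1.
have u0 : 0 < u by rewrite invr_gt0 exprn_gt0.
have u2 : u <= 2^-1.
  rewrite lef_pV2 ?posrE ?exprn_gt0 // -(prednK w0) exprS ler_peMr //.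
  by rewrite exprn_ege1 // ler1n.
pose q : R := 1 - u; pose x : R := q ^+ m.-1.
have x0 : 0 <= x by rewrite exprn_ge0 // subr_ge0; lra.
have qm : q ^+ m = q * x by rewrite -{1}(prednK m0) exprS.
have qmS : q ^+ m.+1 = q ^+ 2 * x by rewrite exprS qm expr2 mulrA.
move: eps_lt eps_ge; rewrite /tribe_false -/u -/q qm qmS => eps_lt eps_ge.
have [pos le3 le_lam lt1] := decoy_weight_bound eps0 eps6 u0 u2 x0 eps_ge.
(* The solution of lam (1 - q^m) = q^(m-1) - q^m = x u. *)
pose lam : R := x * u / (1 - q * x).
have lam0 : 0 <= lam by rewrite divr_ge0 ?mulr_ge0 // ltW.
have lam1 : lam < 1 := le_lt_trans le_lam lt1.
have lamE : (1 - lam) * tribe_false R w ^+ m + lam = tribe_false R w ^+ m.-1.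
  rewrite /tribe_false -/u -/q qm -/x /lam /q; field; exact: lt0r_neq0.
exists (@tribes_dist R d m w), (@corrupted R d m w lam); split.
- by split; [exact: is_dist_tribes | exists (@tribes d m w)].
- by apply: is_dist_corrupted => //; rewrite lam0 ltW.
- apply: (@le_trans _ _ lam); first by apply: dTV_corrupted.
  apply: (le_trans le_lam); apply: le_trans le_eta.
  have : 6 * eps * u <= 6 * eps * (4 * gamma * ln eps^-1) by rewrite ler_pM2l ?mulr_gt0.
  by lra.
- by apply: weak_learning_tribes => //; exact: leq_ltn_trans lt_mw_d.
(* The first coordinate outside the tribes has index m w. *)
move=> G _ t _; pose i0 : 'I_d := Ordinal lt_mw_d.
have le_m_i0 : (m <= blk w i0)%N by rewrite /blk /= mulnK.
have [T [runT onT]] := td_run_only_label w0 le_mw_d lamE G t.-1 le_m_i0.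
exists T; split=> //.
apply: (error_only_label w0 le_mw_d lamE le_m_i0) => //.
- by rewrite lam0.
- by rewrite /tribe_false -/u -/q qm.
- by rewrite /tribe_false -/u -/q qm; move: le3 eps6; rewrite -/q; clear; lra.
Qed.
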